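(* Let \[ A_1=\begin{bmatrix}1&1.1&1.1\\1.1&1&1.1\\1.1&1.1&1\end{bmatrix},\quad A_2=\begin{bmatrix}-2.1&0&0\\0&1&0\\0&0&1\end{bmatrix},\quad A_3=\begin{bmatrix}1&0&0\\0&-2.1&0\\0&0&1\end{bmatrix},\quad A_4=\begin{bmatrix}1&0&0\\0&1&0\\0&0&-2.1\end{bmatrix}, \] $c_1=-1$, $c_2=c_3=c_4=0$, and \[ S=\left\{x\in\mathbb{R}^3 : \begin{bmatrix}x\\1\end{bmatrix}^\top\begin{bmatrix}A_i&0\\0&c_i\end{bmatrix}\begin{bmatrix}x\\1\end{bmatrix}<0,\ i\in\{1,2,3,4\}\right\}. \] For $\lambda\in\mathbb{R}^4_+$ let \[ S_\lambda=\left\{x\in\mathbb{R}^3 : \begin{bmatrix}x\\1\end{bmatrix}^\top\left(\sum_{i=1}^4\lambda_i\begin{bmatrix}A_i&0\\0&c_i\end{bmatrix}\right)\begin{bmatrix}x\\1\end{bmatrix}<0\right\}. \] Then: (a) there exists $\theta\in\mathbb{R}^4$ such that $\sum_{i=1}^4\theta_i\begin{bmatrix}A_i&0\\0&c_i\end{bmatrix}\succ0$; (b) $\mathrm{conv}(S)\neq\mathbb{R}^3$; (c) \[ \mathrm{conv}(S)\subsetneq\bigcap\{S_\lambda : \lambda\in\mathbb{R}^4_+,\ S_\lambda\supseteq\mathrm{conv}(S)\}. \] In particular, $\mathrm{conv}(S)\neq\bigcap_{\lambda\in\Omega}S_\lambda$, where $\Omega=\{\lambda\in\mathbb{R}^4_+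 : S_\lambda\supseteq\mathrm{conv}(S)\text{ and }\nu(S_\lambda)\leq1\}$.
   Context: $\mathbb{R}^4_+$ is the set of vectors in $\mathbb{R}^4$ with all entries nonnegative. For a symmetric matrix $M$, $M\succ0$ means positive definite. $\mathrm{conv}$ denotes the convex hull. $\nu(S_\lambda)$ denotes the number of negative eigenvalues (with multiplicity) of $\sum_{i=1}^4\lambda_iA_i$. *)

(* Defs.v *)
From HB Require Import structures.
From mathcomp Require Import all_boot all_order all_algebra.
From mathcomp Require Import polyrcf.
From mathcomp Require Import all_classical all_reals convex.

Set Implicit Arguments.
Unset Strict Implicit.
Unset Printing Implicit Defensive.

Import Order.TTheory GRing.Theory Num.Theory.
Local Open Scope classical_set_scope.
Local Open Scope ring_scope.

Section General.
Context {R : realType}.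

Definition convex_hull {E : lmodType R} (X : set E) : set E :=
  smallest (@convex_set R E) X.

Definition quad_form {n} (M : 'M[R]_n) (v : 'cV[R]_n) : R :=
  (v^T *m M *m v) ord0 ord0.

Definition posdef {n} (M : 'M[R]_n) : Prop :=
  M^T = M /\ forall v : 'cV[R]_n, v != 0 -> 0 < quad_form M v.

(* Eigenvalues are counted with their algebraic multiplicity; [rootsR] lists
   each real root of the characteristic polynomial once. *)
Definition nu {n} (M : 'M[R]_n) : nat :=
  (\sum_(a <- rootsR (char_poly M) | (a < 0)%R) mup a (char_poly M))%N.

End General.

Section Data.
Context {R : realType}.

Definition mx3 (rows : seq (seq R)) : 'M[R]_3 :=
  \matrix_(i, j) nth 0 (nth [::] rows i) j.

Definition A1 : 'M[R]_3 := mx3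
  [:: [:: 1;       11 / 10; 11 / 10];
      [:: 11 / 10; 1;       11 / 10];
      [:: 11 / 10; 11 / 10; 1      ]].

Definition A2 : 'M[R]_3 := mx3
  [:: [:: - (21 / 10); 0; 0];
      [:: 0;           1; 0];
      [:: 0;           0; 1]].

Definition A3 : 'M[R]_3 := mx3
  [:: [:: 1; 0;           0];
      [:: 0; - (21 / 10); 0];
      [:: 0; 0;           1]].

Definition A4 : 'M[R]_3 := mx3
  [:: [:: 1; 0; 0          ];
      [:: 0; 1; 0          ];
      [:: 0; 0; - (21 / 10)]].

Definition A (i : 'I_4) : 'M[R]_3 := tnth [tuple A1; A2; A3; A4] i.

Definition c (i : 'I_4) : R := tnth [tuple -1; 0; 0; 0] i.

Definition Q (i : 'I_4) : 'M[R]_(3 + 1) := block_mx (A i) 0 0 (c i)%:M.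

Definition homog (x : 'cV[R]_3) : 'cV[R]_(3 + 1) := col_mx x 1%:M.

Definition S_all : set 'cV[R]_3 :=
  [set x | forall i, quad_form (Q i) (homog x) < 0].

Definition aggA (l : 'cV[R]_4) : 'M[R]_3 := \sum_(i < 4) l i ord0 *: A i.

Definition aggQ (l : 'cV[R]_4) : 'M[R]_(3 + 1) :=
  \sum_(i < 4) l i ord0 *: Q i.

Definition S_lam (l : 'cV[R]_4) : set 'cV[R]_3 :=
  [set x | quad_form (aggQ l) (homog x) < 0].

Definition nonneg4 : set 'cV[R]_4 := [set l | forall i, 0 <= l i ord0].

Definition Omega : set 'cV[R]_4 :=
  [set l | [/\ nonneg4 l, convex_hull S_all `<=` S_lam l & (nu (aggA l) <= 1)%N]].

End Data.

(* Main.v *)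
Require Import Defs.
From HB Require Import structures.
From mathcomp Require Import all_boot all_order all_algebra.
From mathcomp Require Import all_classical all_reals.
From mathcomp Require Import convex interval_inference ring lra.

Import Order.TTheory GRing.Theory Num.Theory.
Local Open Scope classical_set_scope.
Local Open Scope ring_scope.

(** Write [s] and [p] for the sum of the coordinates of [x] and the sum of their
    squares. The four homogeneous quadratic forms are [11/10 s^2 - p/10] and
    [p - 31/10 x_i^2], so [S] is a union of eight lobes, one in each open
    octant, symmetric under permutations of the coordinates and [x |-> - x].

    The function [s] attains its supremum over [S], a little below [23/20],
    only in the limit at the vertices of the three lobes with one negative
    coordinate ([lobes_sum_lt]). A half-space contains the convex hull as soon
    as it contains [S], so the point [witness = (121/100, 121/100, -127/100)],
    just outside one of these vertices, is not in the hull
    ([witness_notin_hull]).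

    No aggregation with nonnegative weights [l] can cut the witness off. The
    hull contains [(0, 0, 11/10)], the midpoint of two points in opposite
    lobes with respect to the first two coordinates. Requiring the aggregated
    inequality there forces [l_4] to be large compared with the other weights,
    because the fourth form is the only negative one on the third axis. At the
    witness the fourth form is markedly negative while the other three
    constraints are violated only slightly, so the aggregated inequality holds
    there too ([witness_in_S_lam]). One point therefore refutes all claims that
    the hull equals an intersection of aggregations or the whole space. *)

(** * The quadratic forms in coordinates *)

Section QuadraticForms.
Context {R : realType}.

Lemma quad_form_sum n (M : 'I_4 -> 'M[R]_n) (l : 'I_4 -> R) v :
  quad_form (\sum_i l i *: M i) v = \sum_i l i * quad_form (M i) v.
Proof.
rewrite /quad_form mulmx_sumr mulmx_suml summxE; apply: eq_bigr => i _.
by rewrite -scalemxAr -scalemxAl mxE.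
Qed.

Lemma quad_form_block n (M : 'M[R]_n) k x (z : 'cV[R]_1) :
  quad_form (block_mx M 0 0 k%:M) (col_mx x z) =
  quad_form M x + k * z ord0 ord0 ^+ 2.
Proof.
rewrite /quad_form tr_col_mx mul_row_block !mulmx0 addr0 add0r mul_row_col.
rewrite mxE mul_mx_scalar; congr (_ + _).
by rewrite mxE big_ord1 !mxE; ring.
Qed.

Lemma quad_form3E (M : 'M[R]_3) x :
  quad_form M x = \sum_(i < 3) \sum_(j < 3) M i j * x i ord0 * x j ord0.
Proof.
rewrite /quad_form -mulmxA mxE; apply: eq_bigr => i _.
rewrite !mxE mulr_sumr; apply: eq_bigr => j _; ring.
Qed.

Definition col3 (a b c : R) : 'cV[R]_3 := \col_i nth 0 [:: a; b; c] i.

Lemma col3E (x : 'cV[R]_3) : x = col3 (x 0 0) (x 1 0) (x 2 0).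
Proof.
apply/colP => -[[|[|[|//]]] i3]; rewrite mxE /=; congr (x _ _); exact: val_inj.
Qed.

Definition form (i : 'I_4) (a b c : R) : R :=
  let p := a ^+ 2 + b ^+ 2 + c ^+ 2 in
  tnth [tuple 11 / 10 * (a + b + c) ^+ 2 - p / 10;
              p - 31 / 10 * a ^+ 2; p - 31 / 10 * b ^+ 2;
              p - 31 / 10 * c ^+ 2] i.

Lemma quad_formA i (x : 'cV[R]_3) :
  quad_form (A i) x = form i (x 0 0) (x 1 0) (x 2 0).
Proof.
have e0 : ord0 = 0 :> 'I_3 by [].
have e1 : lift ord0 ord0 = 1 :> 'I_3 by apply/val_inj.
have e2 : lift ord0 (lift ord0 ord0) = 2 :> 'I_3 by apply/val_inj.
rewrite quad_form3E !big_ord_recl !big_ord0 e0 e1 e2 /A /form.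
by case: i => -[|[|[|[|//]]]] i4; rewrite !(tnth_nth 0) /= !mxE /=; field.
Qed.

Lemma quad_formQ i x (z : 'cV[R]_1) :
  quad_form (Q i) (col_mx x z) =
  form i (x 0 0) (x 1 0) (x 2 0) + c i * z ord0 ord0 ^+ 2.
Proof. by rewrite quad_form_block quad_formA. Qed.

Lemma S_allE (x : 'cV[R]_3) (a := x 0 0) (b := x 1 0) (d := x 2 0) :
  S_all x <-> [/\ form 0 a b d < 1, form 1 a b d < 0, form 2 a b d < 0
                & form 3 a b d < 0].
Proof.
split=> [Sx|[h1 h2 h3 h4]].
  have q i : form i a b d + c i < 0.
    by have := Sx i; rewrite quad_formQ mxE expr1n mulr1.
  have := (q 0, q 1, q 2, q 3); rewrite /c !(tnth_nth 0) /=.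
  by move=> [[[]]]; rewrite subr_lt0 !addr0.
move=> i; rewrite quad_formQ !mxE /= expr1n mulr1.
case: i => -[|[|[|[|//]]]] i4; rewrite /c (tnth_nth 0) /=.
- by rewrite (val_inj _ : Ordinal i4 = 0) // subr_lt0.
- by rewrite (val_inj _ : Ordinal i4 = 1) // addr0.
- by rewrite (val_inj _ : Ordinal i4 = 2) // addr0.
- by rewrite (val_inj _ : Ordinal i4 = 3) // addr0.
Qed.

Lemma S_lamE l (x : 'cV[R]_3) :
  S_lam l x <->
  \sum_i l i ord0 * form i (x 0 0) (x 1 0) (x 2 0) < l 0 ord0.
Proof.
have q i : l i ord0 * quad_form (Q i) (homog x) =
    l i ord0 * form i (x 0 0) (x 1 0) (x 2 0) + l i ord0 * c i.
  by rewrite quad_formQ mxE expr1n mulr1 mulrDr.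
rewrite /S_lam /= quad_form_sum (eq_bigr _ (fun i _ => q i)).
rewrite big_split /= [X in _ + X < _](_ : _ = - l 0 ord0) ?subr_lt0 //.
rewrite !big_ord_recl big_ord0 /c !(tnth_nth 0) /=.
by rewrite !mulr0 !addr0 mulrN1.
Qed.

End QuadraticForms.

(** * Convex hulls *)

Section Hull.
Context {R : realType}.

Lemma convex_hull_midpoint (E : lmodType R) (X : set E) x y :
  X x -> X y -> convex_hull X (2^-1 *: (x + y)).
Proof.
move=> Xx Xy C [cC XC].
have h01 : Itv.spec (@Itv.num_sem R) (Itv.Real `[0%Z, 1%Z]) (2^-1 : R).
  by rewrite /= /Itv.num_sem /= num_real in_itv /=; lra.
pose h : {i01 R} := Itv.mk h01.
have := cC x y h (mem_set (XC _ Xx)) (mem_set (XC _ Xy)).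
rewrite inE; congr (C _).
rewrite /conv /= /h /= scalerDr; congr (_ + _ *: _).
by rewrite /unstable.onem; field.
Qed.

Lemma convex_hull_sub_halfspace (E : lmodType R) (X : set E)
    (f : {scalar E}) (r : R) :
  (forall x, X x -> f x < r) -> forall x, convex_hull X x -> f x < r.
Proof.
move=> Xr; apply: (smallest_sub (X := [set x | f x < r])) => //.
move=> x y k; rewrite !inE /= => xr yr.
rewrite linearD !linearZ /= /unstable.onem.
have k0 : 0 <= k%:num by apply: ge0.
have k1 : k%:num <= 1 by apply: le1.
move: (k%:num) k0 k1 => t.
by rewrite le_eqVlt => /orP[/eqP<-|t0] t1; nra.
Qed.

End Hull.

(** * The witness *)

Section Separation.
Context {R : realType}.

(** The extremal lobes. The ratio of [a + b + d] to the norm is smallest when the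
    two positive coordinates agree and [d] is as negative as the cone allows;
    on that ray the first form leaves the most room for the sum. *)
Lemma one_neg_bound (a b d : R) :
  0 < a -> 0 < b -> d < 0 -> form 0 a b d < 1 -> form 1 a b d < 0 ->
  form 2 a b d < 0 -> a + b + d < 23 / 20.
Proof.
rewrite /form !(tnth_nth 0) /=.
wlog ab : a b / a <= b => [hw a0 b0 d0 q1 qa qb|a0 _ d0 q1 qa _].
  have [ab|/ltW ba] := leP a b; first exact: hw.
  by rewrite [a + b]addrC; apply: hw => //; lra.
(* The second form gives [d^2 < 21/10 a^2 - b^2 <= 11/10 a^2], and
   [1049/1000] is a rational just above the square root of [11/10]. *)
have d_lb : - d < 1049 / 1000 * a by nra.
(* Since [p < 31/10 a^2], this bounds [p] by a multiple of [s^2], and then the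
   first form bounds [s^2]. *)
have s_lb : 951 / 1000 * a < a + b + d by lra.
by nra.
Qed.

(** The forms on [b] and [d] give [a^2 < 11/10 min(b^2, d^2)], so [a] cannot
    compensate for both negative coordinates. *)
Lemma two_neg_bound (a b d : R) :
  0 < a -> b < 0 -> d < 0 -> form 2 a b d < 0 -> form 3 a b d < 0 ->
  a + b + d < 0.
Proof. by rewrite /form !(tnth_nth 0) /= => a0 b0 d0 qb qd; nra. Qed.

Lemma lobes_sum_lt (a b d : R) :
  form 0 a b d < 1 -> form 1 a b d < 0 -> form 2 a b d < 0 ->
  form 3 a b d < 0 -> a + b + d < 23 / 20.
Proof.
(* Taking [d] to be the least coordinate leaves, up to exchanging [a] and [b],
   one case for each number of negative coordinates. *)
wlog [da db] : a b d / d <= a /\ d <= b => [hw|q1 qa qb qd].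
  move=> q1 qa qb qd; have := (q1, qa, qb, qd).
  rewrite {1 2 3 4}/form !(tnth_nth 0) /= => -[[[p1 pa] pb] pd].
  have [ab|ba] := leP a b; last have [db|bd] := leP d b.
  - have [da|ad] := leP d a; first by apply: hw => //; split; lra.
    suff : b + d + a < 23 / 20 by lra.
    by apply: hw; rewrite ?/form ?(tnth_nth 0) /=; [split|..]; lra.
  - by apply: hw => //; split; lra.
  - suff : a + d + b < 23 / 20 by lra.
    by apply: hw; rewrite ?/form ?(tnth_nth 0) /=; [split|..]; lra.
have qb' : form 1 b a d < 0.
  by move: qb; rewrite /form !(tnth_nth 0) /=; lra.
have qa' : form 2 b a d < 0.
  by move: qa; rewrite /form !(tnth_nth 0) /=; lra.
have qd' : form 3 b a d < 0.
  by move: qd; rewrite /form !(tnth_nth 0) /=; lra.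
have nz (t : R) : a ^+ 2 + b ^+ 2 + d ^+ 2 - 31 / 10 * t ^+ 2 < 0 -> t != 0.
  by apply: contraTneq => ->; rewrite -leNgt; nra.
have d0 : d != 0 := nz _ qd.
have [d_lt|d_gt|/eqP] := ltgtP d 0; last by rewrite (negPf d0).
  have [a_lt|a_gt|/eqP] := ltgtP a 0; last by rewrite (negPf (nz _ qa)).
    have [b_le|b_gt] := leP b 0; first by lra.
    by have := two_neg_bound b a d b_gt a_lt d_lt qa' qd'; lra.
  have [b_lt|b_gt|/eqP] := ltgtP b 0; last by rewrite (negPf (nz _ qb)).
    by have := two_neg_bound a b d a_gt b_lt d_lt qb qd; lra.
  exact: one_neg_bound.
(* With all coordinates positive [p <= s^2], so the first form gives [s < 1]. *)
by move: q1; rewrite /form !(tnth_nth 0) /=; nra.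
Qed.

Lemma S_all_sum_lt (x : 'cV[R]_3) :
  S_all x -> x 0 0 + x 1 0 + x 2 0 < 23 / 20.
Proof. by move=> /S_allE[]; exact: lobes_sum_lt. Qed.

Definition coord_sum (x : 'cV[R]_3) : R := x 0 0 + x 1 0 + x 2 0.

Fact coord_sum_is_linear : linear_for *%R coord_sum.
Proof. by move=> k x y; rewrite /coord_sum !mxE; ring. Qed.

HB.instance Definition _ :=
  GRing.isLinear.Build R 'cV[R]_3 R *%R coord_sum coord_sum_is_linear.

Lemma convex_hull_sum_lt (x : 'cV[R]_3) :
  convex_hull S_all x -> coord_sum x < 23 / 20.
Proof.
exact: (convex_hull_sub_halfspace _ _ (coord_sum : {scalar _}) _ S_all_sum_lt).
Qed.

(** The exact vertex is proportional to [(1, 1, - sqrt (11/10))]; the rational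
    coordinates put the sum at exactly [23/20] and keep the violation of the
    first three constraints below [1/400]. *)
Definition witness : 'cV[R]_3 := col3 (121 / 100) (121 / 100) (- (127 / 100)).

Lemma witness_notin_hull : ~ convex_hull S_all witness.
Proof. by move=> /convex_hull_sum_lt; rewrite /coord_sum !mxE /=; lra. Qed.

(** The points [(t, -t, t)] and [(-t, t, t)] satisfy all four constraints as
    long as [4/5 t^2 < 1], whereas on the third axis the first form alone would
    only allow [t < 1]. *)
Lemma axis_point_in_hull : convex_hull S_all (col3 0 0 (11 / 10) : 'cV[R]_3).
Proof.
pose t : R := 11 / 10.
rewrite (_ : col3 0 0 _ = 2^-1 *: (col3 t (- t) t + col3 (- t) t t)).
  by apply: convex_hull_midpoint; apply/S_allE; rewrite !mxE /form !(tnth_nth 0) /t /=;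
    split; lra.
by apply/colP => -[[|[|[|//]]] i3]; rewrite !mxE /= /t; field.
Qed.

(** The axis point gives [2541 l_4 > 210 l_1 + 1210 l_2 + 1210 l_3] after
    clearing denominators. The fourth form is about [-46/100] at the witness, so
    [l_4] times it outweighs the excess of the other terms. *)
Lemma witness_in_S_lam (l : 'cV[R]_4) :
  nonneg4 l -> convex_hull S_all `<=` S_lam l -> S_lam l witness.
Proof.
move=> l0 /(_ _ axis_point_in_hull) /S_lamE axis; apply/S_lamE; move: axis.
have := (l0 0, l0 1, l0 2, l0 3) => -[[[]]].
have e0 : ord0 = 0 :> 'I_4 by [].
have e1 : lift ord0 ord0 = 1 :> 'I_4 by apply/val_inj.
have e2 : lift ord0 (lift ord0 ord0) = 2 :> 'I_4 by apply/val_inj.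
have e3 : lift ord0 (lift ord0 (lift ord0 ord0)) = 3 :> 'I_4 by apply/val_inj.
rewrite !big_ord_recl !big_ord0 e0 e1 e2 e3 !mxE /form !(tnth_nth 0) /=.
move: (l 0 0) (l 1 0) (l 2 0) (l 3 0) => l1 l2 l3 l4; lra.
Qed.

Lemma aggQ_posdef : exists theta : 'cV[R]_4, posdef (aggQ theta).
Proof.
(* A weight [-1] on the first form makes the constant entry positive and leaves
   [-11/10 s^2 + p/10]. The other three forms add up to [-p/10], so weight [-40]
   on each contributes [4 p], and [41/10 p > 11/10 s^2] as [s^2 <= 3 p]. *)
exists (\col_i nth 0 [:: -1; - 40; - 40; - 40] i); split.
  rewrite /aggQ raddf_sum; apply: eq_bigr => i _.
  rewrite /= linearZ /= tr_block_mx !trmx0 tr_scalar_mx; congr (_ *: block_mx _ _ _ _).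
  apply/matrixP => j k; rewrite mxE /A.
  by case: i j k => -[|[|[|[|//]]]] i4 [[|[|[|//]]] j3] [[|[|[|//]]] k3];
    rewrite !(tnth_nth 0) /= !mxE.
move=> v; rewrite -[v]vsubmxK; move: (usubmx v) (dsubmx v) => x z v0.
rewrite quad_form_sum.
have q i : (\col_i nth 0 [:: -1; - 40; - 40; - 40] i : 'cV[R]_4) i ord0 *
  quad_form (Q i) (col_mx x z) = nth 0 [:: -1; - 40; - 40; - 40] i *
     (form i (x 0 0) (x 1 0) (x 2 0) + c i * z ord0 ord0 ^+ 2).
  by rewrite mxE quad_formQ.
rewrite (eq_bigr _ (fun i _ => q i)).
rewrite !big_ord_recl !big_ord0 /form /c !(tnth_nth 0) /=.
have : (x 0 0 != 0) || (x 1 0 != 0) || (x 2 0 != 0) || (z 0 0 != 0).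
  apply: contraNT v0; rewrite !negb_or !negbK => /andP[/andP[/andP[]]].
  move=> /eqP x0 /eqP x1 /eqP x2 /eqP z0; apply/eqP.
  have -> : x = 0.
    by rewrite [x]col3E x0 x1 x2 [RHS]col3E !mxE.
  have -> : z = 0 by apply/colP => i; rewrite ord1 z0 mxE.
  by rewrite col_mx0.
have sq (t : R) : (t != 0) = (0 < t ^+ 2) by rewrite exprn_even_gt0.
have sqge (t : R) : 0 <= t ^+ 2 := sqr_ge0 t.
rewrite !sq; move: (x 0 0) (x 1 0) (x 2 0) (z 0 0) => a b d w.
have := (sqge (a - b), sqge (a - d), sqge (b - d), sqge a, sqge b, sqge d, sqge w).
by move=> [[[[[[]]]]]] ? ? ? ? ? ? ? /orP[/orP[/orP[]|]|]; lra.
Qed.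

End Separation.

Theorem proposition2 (R : realType) :
  [/\ exists theta : 'cV[R]_4, posdef (aggQ theta),
      convex_hull (@S_all R) <> setT,
      convex_hull (@S_all R) `<`
        \bigcap_(l in [set l : 'cV[R]_4 |
                        nonneg4 l /\ convex_hull S_all `<=` S_lam l]) S_lam l
    & convex_hull (@S_all R) <> \bigcap_(l in @Omega R) S_lam l].
Proof.
split.
- exact: aggQ_posdef.
- by move=> hullT; apply: (@witness_notin_hull R); rewrite hullT.
- split=> [x Sx l [_]|eqS]; first exact.
  by apply: (@witness_notin_hull R); apply: eqS => l []; exact: witness_in_S_lam.
- move=> eqS; apply: (@witness_notin_hull R); rewrite eqS => l [l0 lS _].
  exact: witness_in_S_lam.
Qed.
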